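(* For every conduct $\mathbf{A}$, the conducts $\mathbf{A}$ and $\mathbf{A}^\perp$ are not both true.
   Context: Graphs. A directed weighted graph is a tuple $G=(V_G,E_G,s_G,t_G,\omega_G)$. Here $V_G$ is a finite vertex set, $E_G$ is a finite or countable edge set, $s_G,t_G$ are the source and target maps, and $\omega_G:E_G\to(0,1]$ gives the weights; $E_G(v,w)$ denotes the edges from $v$ to $w$. Paths are finite sequences of consecutive edges, with weight the product of weights; cycles are closed paths. A $1$-cycle is a cycle not of the form $\rho^k$ with $k\ge 2$. A $1$-circuit is the class of a $1$-cycle under cyclic permutation. - $G\cup H$ has vertex set $V_G\cup V_H$ and edge set $E_G\sqcup E_H$, with edges coloured by origin. - Alternating paths alternate colours. Alternating cycles additionally have first and last edges of different colours. $\mathrm{Cycl}(G,H)$ is the set of alternating $1$-circuits. - $\langle G,H\rangle=\sum_{\pi\in\mathrm{Cycl}(G,H)}-\log(1-\omega(\pi))$, with $-\log0=\infty$. Projects. - A project is $(a,A)$ with $a\in[0,\infty)$ and $A$ a graph; its carrier is $V_A$. - $\langle\!\langle\mathfrak{a},\mathfrak{b}\rangle\!\rangle=a+b+\langle A,B\rangle$. Projects of the same carrier are orthogonal if this is $\notin\{0,\infty\}$. - $S^\perp$ is the set of projects orthogonal to all elements of $S$. A conduct is a nonempty set of projects of a common carrier with $\mathbf{A}=\mathbf{A}^{\perp\perp}$. Success. - $\hat G$ is the simple graph on $V_G$ with one edge $(v,w)$ whenever $E_G(v,w)\neq\emptyset$, of weight $\sum_{e\in E_G(v,w)}\omega(e)$.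 - $G^k$ is the graph on $V_G$ whose edges are the paths of $k$ edges in $G$, with their source, target and weight. - $G$ is symmetric if for all $v,w$ there is a weight-preserving bijection $E_G(v,w)\to E_G(w,v)$. - $\mathrm{Tr}(G)=\sum_v\sum_{e\in E_G(v,v)}\omega(e)$. - A project $(a,A)$ is successful if $a=0$, $\hat A$ is symmetric, $(\hat A)^3=\hat A$, and $\mathrm{Tr}(A)=0$. A conduct is true if it contains a successful project. *)

(* Defs.v *)
From HB Require Import structures.
From mathcomp Require Import all_boot all_order all_algebra finmap.
From mathcomp Require Import all_classical all_reals all_analysis.

Set Implicit Arguments.
Unset Strict Implicit.
Unset Printing Implicit Defensive.

Import Order.TTheory GRing.Theory Num.Theory.

Local Open Scope classical_set_scope.
Local Open Scope fset_scope.
Local Open Scope ring_scope.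
Local Open Scope ereal_scope.

(* Vertices are drawn from an ambient type U, so that unions of vertex sets
   and equality of carriers make sense. Weights of a wgraph are extended
   reals, because the total weight of a countable set of edges (see simplify)
   can exceed 1 and even be infinite; graph restores the weights in (0,1]. *)
Record wgraph (R : realType) (U : choiceType) := WGraph {
  vert : {fset U};
  edge : countType;
  src : edge -> U;
  tgt : edge -> U;
  weight : edge -> \bar R;
  src_vert : forall e, src e \in vert;
  tgt_vert : forall e, tgt e \in vert }.

Record graph (R : realType) (U : choiceType) := Graph {
  graph_val :> wgraph R U;
  weight_in01 : forall e : edge graph_val, 0 < weight e <= 1 }.

Section Graphs.
Variables (R : realType) (U : choiceType).
Implicit Types G H : wgraph R U.

Definition edges G (v w : U) : set (edge G) :=
  [set e | src e = v /\ tgt e = w].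
Arguments edges : clear implicits.

Definition consecutive G : rel (edge G) := [rel e f | tgt e == src f].

Definition pweight G (s : seq (edge G)) : \bar R := \prod_(e <- s) weight e.

(* [cycle] from path.v asks in addition that the last edge be followed by the
   first one. *)
Definition is_cycle G (s : seq (edge G)) : Prop :=
  s != [::] /\ cycle (@consecutive G) s.

Definition is_one_cycle G (s : seq (edge G)) : Prop :=
  is_cycle s /\
  ~ exists (r : seq (edge G)) (k : nat),
      [/\ is_cycle r, (2 <= k)%N & s = flatten (nseq k r)].

Definition circuit_of (T : Type) (s : seq T) : set (seq T) :=
  [set rot i s | i in [set: nat]].

(* All the members of a circuit have the same weight, so the choice of a
   representative is immaterial. *)
Definition circuit_weight G (c : set (seq (edge G))) : \bar R :=
  pweight (xget [::] c).

Section Union.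
Variables G H : wgraph R U.

Definition usrc (e : edge G + edge H) : U :=
  match e with inl e => src e | inr e => src e end.
Definition utgt (e : edge G + edge H) : U :=
  match e with inl e => tgt e | inr e => tgt e end.
Definition uweight (e : edge G + edge H) : \bar R :=
  match e with inl e => weight e | inr e => weight e end.

Fact usrc_vert e : usrc e \in vert G `|` vert H.
Proof. by case: e => e; rewrite in_fsetU src_vert ?orbT. Qed.

Fact utgt_vert e : utgt e \in vert G `|` vert H.
Proof. by case: e => e; rewrite in_fsetU tgt_vert ?orbT. Qed.

Definition gunion : wgraph R U :=
  @WGraph R U (vert G `|` vert H) (edge G + edge H)%type usrc utgt uweight
    usrc_vert utgt_vert.

Definition colour (e : edge gunion) : bool := if e is inl _ then true else false.

(* Cyclic alternation: consecutive edges, and also the last and the first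
   one, have different colours. *)
Definition alternating_cycle (s : seq (edge gunion)) : Prop :=
  is_cycle s /\ cycle [rel e f | colour e != colour f] s.

Definition Cycl : set (set (seq (edge gunion))) :=
  [set c | exists s, [/\ alternating_cycle s, is_one_cycle s
                       & c = circuit_of s]].

End Union.
Arguments Cycl : clear implicits.

(* [lne 0 = -oo]. *)
Definition interaction (G H : graph R U) : \bar R :=
  \esum_(c in Cycl G H) - lne (1 - circuit_weight c).

Section Simplify.
Variable G : wgraph R U.

Definition hedge := {p : vert G * vert G | `[< edges G (val p.1) (val p.2) !=set0 >]}.
Definition hsrc (p : hedge) : U := val (val p).1.
Definition htgt (p : hedge) : U := val (val p).2.
Definition hweight (p : hedge) : \bar R :=
  \esum_(e in edges G (hsrc p) (htgt p)) weight e.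

Fact hsrc_vert p : hsrc p \in vert G. Proof. exact: valP. Qed.

Fact htgt_vert p : htgt p \in vert G. Proof. exact: valP. Qed.

(* The simple graph written with a hat. *)
Definition simplify : wgraph R U :=
  @WGraph R U (vert G) hedge hsrc htgt hweight hsrc_vert htgt_vert.

End Simplify.

Section Power.
Variables (G : wgraph R U) (k : nat).

(* A path is given with its starting vertex, which only carries information
   for the empty paths (k = 0). *)
Definition is_path_from (v : U) (s : seq (edge G)) : bool :=
  if s is e :: s' then (src e == v) && path (@consecutive G) e s' else true.

Definition kpath := {p : vert G * k.-tuple (edge G) | is_path_from (val p.1) p.2}.
Definition ksrc (p : kpath) : U := val (val p).1.
Definition ktgt (p : kpath) : U := last (ksrc p) (map (@tgt R U G) (val p).2).
Definition kweight (p : kpath) : \bar R := pweight (val p).2.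

Fact ksrc_vert p : ksrc p \in vert G. Proof. exact: valP. Qed.

Fact ktgt_vert p : ktgt p \in vert G.
Proof.
have := mem_last (ksrc p) (map (@tgt R U G) (val p).2).
rewrite -/(ktgt p) inE => /orP[/eqP ->|/mapP[e _ ->]]; first exact: ksrc_vert.
exact: tgt_vert.
Qed.

Definition gpow : wgraph R U :=
  @WGraph R U (vert G) kpath ksrc ktgt kweight ksrc_vert ktgt_vert.

End Power.

(* Equality of graphs up to renaming of edges, the vertices being fixed: the
   edges of a power are sequences of edges, so literal equality would be
   meaningless. *)
Definition graph_eq G H : Prop :=
  vert G = vert H /\
  exists f : edge G -> edge H,
    bijective f /\
    forall e, [/\ src (f e) = src e, tgt (f e) = tgt e
                & weight (f e) = weight e].

Definition symmetric_graph G : Prop :=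
  forall v w, v \in vert G -> w \in vert G ->
  exists f : edge G -> edge G,
    set_bij (edges G v w) (edges G w v) f /\
    forall e, edges G v w e -> weight (f e) = weight e.

Definition trace G : \bar R :=
  \sum_(v <- vert G) \esum_(e in edges G v v) weight e.

End Graphs.
Arguments edges {R U} G v w.
Arguments Cycl {R U} G H.

Record project (R : realType) (U : choiceType) := Project {
  wager : R;
  pgraph : graph R U;
  wager_ge0 : (0 <= wager)%R }.

Section Projects.
Variables (R : realType) (U : choiceType).
(* Predicates on projects rather than [set]s: the type of projects, which
   quantifies over countTypes, is too large for the universe of [set]. *)
Implicit Types (a b : project R U) (S : project R U -> Prop).

Definition carrier a : {fset U} := vert (pgraph a).

Definition measurement a b : \bar R :=
  (wager a)%:E + (wager b)%:E + interaction (pgraph a) (pgraph b).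

Definition orthogonal_projects a b : Prop :=
  [/\ carrier a = carrier b, measurement a b <> 0 & measurement a b <> +oo].

Definition perp S : project R U -> Prop :=
  fun b => forall a, S a -> orthogonal_projects b a.

Definition conduct S : Prop :=
  [/\ (exists a, S a),
      (exists V : {fset U}, forall a, S a -> carrier a = V)
    & forall a, S a <-> perp (perp S) a].

Definition successful a : Prop :=
  [/\ wager a = 0%R,
      symmetric_graph (simplify (pgraph a)),
      graph_eq (gpow (simplify (pgraph a)) 3) (simplify (pgraph a))
    & trace (pgraph a) = 0].

Definition true_conduct S : Prop := exists2 a, S a & successful a.

End Projects.

(* Main.v *)
Require Import Defs.
From mathcomp Require Import all_boot all_order all_algebra.
From mathcomp Require Import all_classical all_reals.
From mathcomp Require Import all_analysis.
From mathcomp Require Import finmap ring lra zify.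

Set Implicit Arguments.
Unset Strict Implicit.
Unset Printing Implicit Defensive.
Import Order.TTheory GRing.Theory Num.Theory.
Local Open Scope classical_set_scope.
Local Open Scope ring_scope.
Local Open Scope ereal_scope.

(** The equation [c ^ 3 = c] forces the total weight of every nonempty bundle
    of parallel edges of a successful graph to be 1 or infinite, hence at least
    1. If two such graphs have an alternating cycle, take one of minimal length;
    no other edge of it is parallel to its first edge [a]. If its edges all have
    weight 1, its circuit already contributes [- log 0 = +oo]. Otherwise rotate
    it so that [p = w a < 1]. Call X (resp. Y) the set of cycles parallel to it
    whose first edge is [a] (resp. is not): they have mass at least [p] and
    [1 - p]. The words [X^k Y (X^j Y with j < k)^m] have a unique longest cyclic
    run of X-letters, so they are 1-cycles lying in pairwise distinct circuits,
    and their total mass is at least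
    [\sum_k p^k (1 - p) \sum_m (1 - p^k)^m = \sum_k (1 - p) = +oo]. Since
    [- log (1 - x) >= x], the interaction is infinite. So it is 0 or infinite,
    and two successful projects are never orthogonal. *)

(** * Lower bounds for sums of nonnegative extended reals *)

Section ExtendedSums.
Variable R : realType.

Lemma le_esum_subset (T : choiceType) (A B : set T) (f : T -> \bar R) :
  A `<=` B -> \esum_(i in A) f i <= \esum_(i in B) f i.
Proof.
move=> AB; apply: le_ereal_sup => _ [X [finX XA] <-].
by exists X => //; split=> //; exact: subset_trans AB.
Qed.

Lemma le_mule_esum (T : choiceType) (A : set T) (c : R) (f : T -> \bar R) :
  (0 <= c)%R -> (forall i, 0 <= f i) ->
  c%:E * (\esum_(i in A) f i) <= \esum_(i in A) (c%:E * f i).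
Proof.
rewrite le_eqVlt => /predU1P[<- f0|c0 f0].
  by rewrite mul0e esum_ge0// => i _; rewrite mul0e.
rewrite muleC -lee_pdivlMr//.
apply: ge_ereal_sup => _ [X [finX XA] <-].
rewrite lee_pdivlMr// muleC ge0_mule_fsumr//.
by apply: ereal_sup_ubound; exists X.
Qed.

Lemma esum_cst_pinfty (c : R) :
  (0 < c)%R -> \esum_(k in [set: nat]) c%:E = +oo.
Proof.
move=> c0; apply/eqyP => A A0.
(* More than [A / c] terms equal to [c] add up to more than [A]. *)
apply: (@le_trans _ _ (\sum_(k < (Num.truncn (A / c)).+1) c%:E)).
  rewrite sumEFin lee_fin sumr_const card_ord -mulr_natr -ler_pdivrMl// mulrC.
  exact/ltW/truncnS_gt.
rewrite -(big_mkord xpredT (fun=> c%:E)).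
rewrite -nneseries_esumT => [|n]; last by rewrite lee_fin ltW.
by apply: nneseries_lim_ge => i _ _; rewrite lee_fin ltW.
Qed.

(** The ratio [1 - a] lies in [0, 1), so the series converges to a / (1 - (1 - a)) = 1. *)
Lemma esum_geometric_ge1 (a : R) : (0 < a <= 1)%R ->
  1 <= \esum_(m in [set: nat]) (a * (1 - a) ^+ m)%:E.
Proof.
move=> /andP[a0 a1]; have h m : (0 <= a * (1 - a) ^+ m)%R.
  by apply: mulr_ge0; [exact: ltW|rewrite exprn_ge0// subr_ge0].
rewrite -nneseries_esumT => [|m]; last by rewrite lee_fin.
rewrite le_eqVlt; apply/orP; left; apply/eqP.
have norm1a : (`|1 - a| < 1)%R by rewrite ger0_norm ?subr_ge0// ltrBlDr ltrDl.
have lim1 : (a * (1 - (1 - a))^-1 = 1 :> R)%R.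
  by rewrite opprB addrC subrK divff// gt_eqF.
apply/esym/cvg_lim => //; apply/fine_cvgP; split.
  by apply: nearW => n; rewrite sumEFin.
have := @cvg_geometric_series R a (1 - a)%R norm1a; rewrite lim1.
by apply: cvg_trans; apply: near_eq_cvg; apply: nearW => n /=; rewrite sumEFin.
Qed.

(** The cartesian product of a list of sets; its members are sequences, so that they can later be
    flattened into words. *)
Fixpoint prodset (T : Type) (As : seq (set T)) (s : seq T) : Prop :=
  match As, s with
  | [::], [::] => True
  | A :: As', x :: s' => A x /\ prodset As' s'
  | _, _ => False
  end.

(** Distributivity, by induction on [l]: the sum over sequences is a double sum over head and
    tail. *)
Lemma esum_prodset_ge (I : eqType) (T : choiceType) (w : T -> R)
    (A : I -> set T) (r : I -> R) (l : seq I) :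
    (forall x, (0 <= w x)%R) ->
    (forall i, i \in l -> (0 <= r i)%R /\ (r i)%:E <= \esum_(x in A i) (w x)%:E) ->
  (\prod_(i <- l) r i)%:E
    <= \esum_(s in prodset (map A l)) (\prod_(x <- s) w x)%:E.
Proof.
move=> w0; elim: l => [_|i l IH h].
  rewrite big_nil [X in esum X](_ : _ = [set [::]]) ?esum_set1 ?big_nil//.
  by apply/seteqP; split=> -[].
have [ri0 riA] := h _ (mem_head _ _).
have {}h j : j \in l -> (0 <= r j)%R /\ (r j)%:E <= \esum_(x in A j) (w x)%:E.
  by move=> lj; apply: h; rewrite inE lj orbT.
have {}IH := IH h.
have prodl0 : (0 <= \prod_(j <- l) r j)%R.
  by rewrite big_seq prodr_ge0// => j /h[].
have prodw0 s : (0 <= \prod_(x <- s) w x)%R by exact: prodr_ge0.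
rewrite (@reindex_esum _ _ _ (A i `*`` (fun=> prodset (map A l))) _
    (fun k => k.1 :: k.2)); last first.
  split=> [[x s]//|[x s] [y t] _ _ /= [-> ->]//|].
  by move=> [|x s] //= [Ax ls]; exists (x, s).
under eq_esum do rewrite big_cons EFinM.
rewrite -(@esum_esum _ _ _ (A i) (fun=> prodset (map A l))
  (fun x s => (w x)%:E * (\prod_(y <- s) w y)%:E)); last first.
  by move=> x s _ _; rewrite -EFinM lee_fin mulr_ge0.
rewrite big_cons mulrC EFinM.
apply: (@le_trans _ _ (\esum_(x in A i) ((\prod_(j <- l) r j)%:E * (w x)%:E))).
  apply: le_trans (le_mule_esum _ _ _) => //.
  by rewrite lee_pmul ?lee_fin.
apply: le_esum => x Ax; rewrite muleC.
apply: le_trans (le_mule_esum _ _ _) => //.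
by rewrite lee_pmul ?lee_fin.
Qed.

Lemma size_prodset (T : Type) (As : seq (set T)) s : prodset As s -> size s = size As.
Proof. by elim: As s => [|A As IH] [|x s]//= [_ /IH ->]. Qed.

Lemma prodset_forall (I : eqType) (T : eqType) (A : I -> set T) (B : set T) l s :
  (forall i, i \in l -> A i `<=` B) -> prodset (map A l) s ->
  forall x, x \in s -> B x.
Proof.
elim: l s => [|i l IH] [|y s]//= h [Ay ls] x; rewrite inE => /predU1P[->|xs].
  exact: h (mem_head _ _) _ Ay.
by apply: IH ls _ xs => j lj; apply: h; rewrite inE lj orbT.
Qed.

End ExtendedSums.

(** * Runs in boolean words, and their rotations *)

Section UniqueRun.
Local Close Scope ereal_scope.
Local Close Scope ring_scope.

(* The leading run of [true]s of [b] is strictly longer than any other one; as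
   [b] ends with [false], no run wraps around. *)
Definition unique_run (b : seq bool) : Prop :=
  last true b = false /\
  forall j, 0 < j < size b -> index false (drop j b) < index false b.

(** If [j] were positive, the leading run of each of [b] and [rot j b] would reappear in the other
    at a positive offset, so each would be strictly longer than the other. *)
Lemma unique_run_rot b j :
  unique_run b -> unique_run (rot j b) -> j < size b -> j = 0.
Proof.
move=> [lastb ub] [lastrb urb] jb; case: (posnP j) => // j0.
have idx_rot i : 0 < i < size b -> index false (rot i b) = index false (drop i b).
  move=> /andP[i0 ib]; rewrite /rot index_cat ifT//.
  case: (lastP (drop i b)) (cat_take_drop i b) (size_drop i b) => [_ /=|s x e _].
    by move/esym/eqP; rewrite subn_eq0 leqNgt ib.
  by rewrite -lastb -e last_cat last_rcons mem_rcons mem_head.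
have /ub : 0 < j < size b by rewrite j0.
have /urb : 0 < size b - j < size (rot j b).
  by rewrite size_rot subn_gt0 jb ltn_subrL j0 (leq_ltn_trans _ jb).
have -> : drop (size b - j) (rot j b) = take j b.
  by rewrite /rot drop_size_cat// size_drop.
rewrite idx_rot ?j0// => lt1 lt2.
(* [take j b] is the end of [rot j b], so it ends with [false] and has the same leading run as
   [b]. *)
have take_false : false \in take j b.
  move: lastrb; rewrite /rot last_cat; case: (take j b) (size_takel (ltnW jb)) => /=.
    by move=> j_eq0; rewrite -j_eq0 in j0.
  by move=> x t _ <-; exact: mem_last.
by move: (ltn_trans lt1 lt2); rewrite -{2}(cat_take_drop j b) index_cat take_false ltnn.
Qed.

Lemma unique_run_flatten k ks : all (fun i => i < k) ks ->
  unique_run (flatten [seq rcons (nseq i true) false | i <- k :: ks]).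
Proof.
have drop_run i t j : j <= i ->
    index false (drop j (rcons (nseq i true) false ++ t)) = i - j.
  move=> ji; rewrite cat_rcons -(subnKC ji) nseqD -catA drop_size_cat ?size_nseq//.
  by rewrite addKn; elim: (i - j) => //= n ->.
have lastF ls b : last b (flatten [seq rcons (nseq i true) false | i <- ls]) =
    if ls is [::] then b else false.
  by elim: ls b => //= i ls IH b; rewrite last_cat last_rcons IH; case: ls {IH}.
move=> ksk; split; first by rewrite lastF.
move=> j /andP[j0 /= jb]; have := drop_run k (flatten [seq rcons (nseq i true) false | i <- ks]) 0 isT.
rewrite drop0 subn0 => ->.
case: (leqP j k) => jk; first by rewrite drop_run//; lia.
have szr i : size (rcons (nseq i true) false) = i.+1 by rewrite size_rcons size_nseq.
have {j0} : k < j by [].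
rewrite size_cat szr in jb; rewrite drop_cat szr (ltnNge j) jk /= => _.
have : j - k.+1 < size (flatten [seq rcons (nseq i true) false | i <- ks]) by lia.
(* The offset is now counted from the end of the first block and may be 0; every remaining run is
   shorter than [k] even in full. *)
move: (j - k.+1) => {jb jk}j; elim: ks ksk j => //= i ks IH /andP[ik ksk] j.
rewrite size_cat szr => jb; case: (leqP j i) => ji; first by rewrite drop_run//; lia.
by rewrite drop_cat szr (ltnNge j) ji /=; apply: IH => //; lia.
Qed.

(** * Canonical rotations of words *)

Section Marks.
Variables (T K : eqType) (f : T -> K) (a : T).

Definition marks (s : seq T) : seq bool := [seq e == a | e <- s & f e == f a].

(** As with Lyndon words, at most one rotation has this form: the head condition makes the word
    start at a mark, and the runs of marks single out which one. *)
Definition lyndon_like (s : seq T) : Prop :=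
  ohead (map f s) = Some (f a) /\ unique_run (marks s).

(** Rotating [s] by [i] rotates its marks by the number of marks in [take i s]. By [unique_run_rot]
    this number is 0, whereas the head of [s] gives a mark. *)
Lemma lyndon_like_rot s i :
  lyndon_like s -> lyndon_like (rot i s) -> i < size s -> i = 0.
Proof.
move=> [hs us] [hr ur] ilt.
have catM s1 s2 : marks (s1 ++ s2) = marks s1 ++ marks s2.
  by rewrite /marks filter_cat map_cat.
have ms : marks s = marks (take i s) ++ marks (drop i s) by rewrite -catM cat_take_drop.
have mr : marks (rot i s) = rot (size (marks (take i s))) (marks s).
  by rewrite ms rot_size_cat /rot catM.
have hd_marks t : ohead (map f t) = Some (f a) -> 0 < size (marks t).
  by case: t => //= x t [fx]; rewrite /marks /= fx eqxx.
rewrite mr in ur; have := unique_run_rot us ur.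
have dpos : 0 < size (marks (drop i s)).
  apply: hd_marks; move: hr; rewrite /rot; case: (drop i s) (size_drop i s) => //=.
  by move=> e _; lia.
move=> /(_ _)/eqP; rewrite ms size_cat -[X in X < _]addn0 ltn_add2l => /(_ dpos).
case: i {ms mr ur dpos hr} ilt => // i _.
case: s hs {us} => //= x s [fx]; by rewrite /marks /= fx eqxx.
Qed.

End Marks.

(** * Unique parsing of concatenations, and powers of a word *)

Lemma flatten_uniform_inj (T : eqType) (n : nat) (ss tt : seq (seq T)) : 0 < n ->
  all (fun s => size s == n) ss -> all (fun s => size s == n) tt ->
  flatten ss = flatten tt -> ss = tt.
Proof.
move=> n0; elim: ss tt => [|s ss IH] [|t tt]//=.
- by move=> _ /andP[/eqP ts _] e; move: (congr1 size e); rewrite size_cat ts /=; lia.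
- by move=> /andP[/eqP ts _] _ e; move: (congr1 size e); rewrite size_cat ts /=; lia.
move=> /andP[/eqP ss_n ssn] /andP[/eqP ts_n ttn] /eqP.
by rewrite eqseq_cat ?ss_n// => /andP[/eqP -> /eqP/IH ->].
Qed.

(** Each factor stops at its first letter outside [p], so the concatenation can be parsed from the
    left. *)
Lemma flatten_delimited_inj (T : eqType) (p : pred T) (ss tt : seq (seq T)) :
    (forall s, s \in ss ++ tt -> exists xs y, [/\ s = rcons xs y, all p xs & ~~ p y]) ->
  flatten ss = flatten tt -> ss = tt.
Proof.
have sz xs y t : all p xs -> ~~ p y -> find (predC p) (rcons xs y ++ t) = size xs.
  by move=> + py; elim: xs => /= [|x xs IH]; [rewrite py|case/andP=> -> /IH ->].
elim: ss tt => [|s ss IH] [|t tt]// h.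
- have [xs [y [-> _ _]]] := h t (mem_head _ _).
  by move/(congr1 size); rewrite /= size_cat size_rcons.
- have [xs [y [-> _ _]]] := h s (mem_head _ _).
  by move/(congr1 size); rewrite /= size_cat size_rcons.
have [xs [y [es xp yp]]] := h s (mem_head _ _).
have [xs' [y' [et xp' yp']]] : exists xs y, [/\ t = rcons xs y, all p xs & ~~ p y].
  by apply: h; rewrite mem_cat mem_head orbT.
rewrite /= => e.
have szst : size s = size t.
  rewrite es et !size_rcons -(sz xs y (flatten ss))// -(sz xs' y' (flatten tt))//.
  by rewrite -es -et e.
move/eqP: e; rewrite eqseq_cat// => /andP[/eqP -> /eqP/IH ->]// u.
rewrite mem_cat => /orP[] uin; apply: h; rewrite mem_cat !inE uin ?orbT//.
Qed.

Lemma cycle_flatten_nseq (T : Type) (e : rel T) (n : nat) (t : seq T) :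
  cycle e t -> cycle e (flatten (nseq n t)).
Proof.
case: t => [_|x p /=]; first by elim: n.
case: n => // n; rewrite /= !rcons_path => /andP[px lx].
suff : path e x (p ++ flatten (nseq n (x :: p))) /\
       last x (p ++ flatten (nseq n (x :: p))) = last x p.
  by case=> -> ->.
elim: n => [|n [IHp IHl]] /=; first by rewrite cats0.
by rewrite cat_path last_cat /= px lx IHp IHl.
Qed.

(** Together with [lyndon_like_rot], this is what excludes proper powers. *)
Lemma rot_flatten_nseq (T : Type) (n : nat) (t : seq T) :
  rot (size t) (flatten (nseq n t)) = flatten (nseq n t).
Proof.
case: n => // n; rewrite /= rot_size_cat.
by elim: n => [|n IH] /=; rewrite ?cats0// -catA IH.
Qed.

End UniqueRun.

(** * Words above the powers of a cycle, and their total mass *)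

Section Necklaces.
Variables (R : realType) (T K : choiceType) (f : T -> K) (w : T -> R).
Variables (a : T) (t : seq T).
Hypothesis w_ge0 : forall x, (0 <= w x)%R.
Hypothesis fa_t : f a \notin map f t.

Let fibre x := [set y | f y = f x].
(** As [a] is not in [t], the test [x == a] selects the first position only; the other letters range
    freely over their fibres. *)
Let block (B : set T) := prodset [seq if x == a then B else fibre x | x <- a :: t].
Let X := block [set a].
Let Y := block (fibre a `\` [set a]).
Let is_X (s : seq T) := ohead s == Some a.
(** In the notation of the introduction, [run j] is X^j Y and [word k m] is X^k Y (X^j Y with j <
    k)^m. The booleans say which set each factor is drawn from, the form to which [esum_prodset_ge]
    applies; members stay nested as runs, blocks and letters. *)
Let run j := prodset [seq if b then X else Y | b <- rcons (nseq j true) false].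
Let runs k := [set c | exists2 j, (j < k)%N & run j c].
Let word k m := prodset [seq if b then run k else runs k | b <- true :: nseq m false].

Let a_notin_t : a \notin t.
Proof. by apply: contra fa_t => /(map_f f). Qed.

Let block_map B s : B `<=` fibre a -> block B s -> map f s = map f (a :: t).
Proof.
move=> BA; rewrite /block; move: (a :: t) => l; elim: l s => [|x l IH] [|y s]//=.
by case: eqP => [->|_] [/= + /IH ->]; [move/BA => ->|move=> ->].
Qed.

Let blockP s : X s \/ Y s -> map f s = map f (a :: t).
Proof.
by case; [apply: block_map => _ ->|apply: block_map => x []].
Qed.

Let X_is_X s : X s -> is_X s.
Proof.
by rewrite /X /block /= eqxx; case: s => //= x s [-> _]; rewrite /is_X /= eqxx.
Qed.

Let Y_is_X s : Y s -> ~~ is_X s.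
Proof.
rewrite /Y /block /= eqxx; case: s => //= x s [[_ xa] _].
by rewrite /is_X /=; apply/eqP => -[].
Qed.

Let runP j c : run j c ->
  exists xs y, [/\ c = rcons xs y, size xs = j, forall b, b \in xs -> X b & Y y].
Proof.
rewrite /run; elim: j c => [|j IH] [|b c]//=.
  by case: c => [|? ?] [Yb]// _; exists [::], b.
move=> [Xb /IH[xs [y [-> <- Xxs Yy]]]]; exists (b :: xs), y; split=> // b'.
by rewrite inE => /predU1P[->|/Xxs].
Qed.

Let run_size j c : run j c -> size c = j.+1.
Proof. by move=> /runP[xs [y [-> <- _ _]]]; rewrite size_rcons. Qed.

Let run_is_X j c : run j c ->
  exists xs y, [/\ c = rcons xs y, all is_X xs & ~~ is_X y].
Proof.
move=> /runP[xs [y [-> _ Xxs Yy]]]; exists xs, y; split=> //; last exact: Y_is_X.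
by apply/allP => b /Xxs/X_is_X.
Qed.

Let wordP k m u : word k m u ->
  exists c u', [/\ u = c :: u', size u' = m, run k c & forall d, d \in u' -> runs k d].
Proof.
rewrite /word /=; case: u => // c u' [kc ku']; exists c, u'; split=> //.
  by rewrite (size_prodset ku') size_map size_nseq.
by apply: prodset_forall ku' => i; rewrite mem_nseq => /andP[_ /eqP ->].
Qed.

Let word_run k m u c : word k m u -> c \in u -> exists j, run j c.
Proof.
move=> /wordP[d [u' [-> _ kd ku']]]; rewrite inE => /predU1P[->|/ku'[j _ jc]].
  by exists k.
by exists j.
Qed.

Let word_block k m u b : word k m u -> b \in flatten u -> map f b = map f (a :: t).
Proof.
move=> ku /flattenP[c /(word_run ku)[j /runP[xs [y [-> _ Xxs Yy]]]]].
by rewrite mem_rcons inE => /predU1P[->|/Xxs Xb]; apply: blockP; [right|left].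
Qed.

(** Only the first letter of a block lies in the fibre of [a], so each block gives one mark, which
    tells X from Y. *)
Let word_marks k m u : word k m u -> unique_run (marks f a (flatten (flatten u))).
Proof.
move=> ku.
have -> : marks f a (flatten (flatten u)) = map is_X (flatten u).
  have : forall b, b \in flatten u -> map f b = map f (a :: t) by move=> b /(word_block ku).
  elim: (flatten u) => //= b bs IH hb; rewrite /marks filter_cat map_cat.
  rewrite -/(marks f a (flatten bs)) IH; last by move=> c cbs; apply: hb; rewrite inE cbs orbT.
  case: b hb => [|x s] hb; first by have := hb _ (mem_head _ _).
  have /= [fx fs] := hb _ (mem_head _ _).
  rewrite fx eqxx /= (_ : [seq e <- s | f e == f a] = [::])//.
  apply/eqP; rewrite -[_ == _]negbK -has_filter; apply: contra fa_t => /hasP[y ys /eqP <-].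
  by rewrite -fs map_f.
(* The exponent of a run is its number of blocks minus one, its last block being in Y. *)
rewrite map_flatten (_ : map _ u =
    [seq rcons (nseq i true) false | i <- [seq (size c).-1 | c <- u]]); last first.
  rewrite -map_comp; apply/eq_in_map => c /(word_run ku)[j].
  move=> /run_is_X[xs [y [-> xsX yX]]].
  rewrite map_rcons /= size_rcons (negbTE yX); congr rcons.
  by elim: xs xsX => //= x xs IH /andP[-> /IH ->].
case/wordP: ku => c [u' [-> _ kc ku']] /=; rewrite (run_size kc) /=.
apply: unique_run_flatten; apply/allP => _ /mapP[d /ku'[j jk jd] ->].
by rewrite (run_size jd).
Qed.

Let word_lifts k m u : word k m u ->
  map f (flatten (flatten u)) = flatten (nseq (size (flatten u)) (map f (a :: t))).
Proof.
move=> ku.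
have : forall b, b \in flatten u -> map f b = map f (a :: t) by move=> b /(word_block ku).
elim: (flatten u) => // b bs IH hb; rewrite [flatten (b :: bs)]/= map_cat IH.
  by rewrite hb ?mem_head.
by move=> c cbs; apply: hb; rewrite inE cbs orbT.
Qed.

(** Blocks are recovered by their common length, then runs by their final Y-block; [k] is read off
    the first run and [m] off the number of runs. *)
Let word_inj k m u k' m' u' : word k m u -> word k' m' u' ->
  flatten (flatten u) = flatten (flatten u') -> (k, (m, u)) = (k', (m', u')).
Proof.
move=> ku ku' /(flatten_uniform_inj (n := (size t).+1) (ltn0Sn _)).
have szb l n v : word l n v -> all (fun b => size b == (size t).+1) (flatten v).
  by move=> lv; apply/allP => b /(word_block lv)/(congr1 size); rewrite !size_map => ->.
move=> /(_ (szb _ _ _ ku) (szb _ _ _ ku')) uu'.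
have uE0 : u = u'.
  apply: (@flatten_delimited_inj _ is_X) uu' => c; rewrite mem_cat.
  by move=> /orP[/(word_run ku)|/(word_run ku')] [j /run_is_X].
rewrite -{}uE0 {uu'} in ku' *.
case/wordP: ku' => c [v [uE <- /run_size kc _]].
case/wordP: ku => c' [v' [uE' <- /run_size kc' _]].
by move: uE' kc'; rewrite uE => -[<- <-]; rewrite kc => -[<-].
Qed.

Let weight_ge0 s : (0 <= \prod_(x <- s) w x)%R. Proof. exact: prodr_ge0. Qed.

Definition necklaces : set (seq T) := [set s |
  (exists n, map f s = flatten (nseq n.+1 (map f (a :: t)))) /\ lyndon_like f a s].

Hypothesis wa : (0 < w a < 1)%R.
Hypothesis fibre_ge1 : forall x, x \in a :: t -> 1 <= \esum_(y in fibre x) (w y)%:E.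

(** The fibres over [t] have mass at least 1, so only the first letter can lower the bound. *)
Let block_ge B (r : R) : (0 <= r)%R -> r%:E <= \esum_(x in B) (w x)%:E ->
  r%:E <= \esum_(s in block B) (\prod_(x <- s) w x)%:E.
Proof.
move=> r0 rB.
have -> : r%:E = (\prod_(x <- a :: t) if x == a then r else 1)%:E.
  rewrite big_cons eqxx big_seq big1 ?mulr1// => x xt.
  by case: eqP xt a_notin_t => // -> ->.
apply: esum_prodset_ge => // x xat; case: eqP => _; split=> //.
exact: fibre_ge1.
Qed.

Let Y_ge : (1 - w a)%:E <= \esum_(s in Y) (\prod_(x <- s) w x)%:E.
Proof.
have /andP[wa0 wa1] := wa.
apply: block_ge; first by rewrite subr_ge0 ltW.
rewrite EFinB leeBlDl//; apply: le_trans (fibre_ge1 (mem_head _ _)) _.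
rewrite (esumID [set a]) => [|x _]; last by rewrite lee_fin.
rewrite setDE leeD2r//; apply: le_trans (le_esum_subset _ _) _.
  exact: subIsetr.
by rewrite esum_set1// lee_fin ltW.
Qed.

Let run_ge j : (w a ^+ j * (1 - w a))%:E <=
  \esum_(c in run j) (\prod_(s <- c) \prod_(x <- s) w x)%:E.
Proof.
have /andP[wa0 wa1] := wa.
have -> : (w a ^+ j * (1 - w a) =
    \prod_(b <- rcons (nseq j true) false) if b then w a else 1 - w a)%R.
  rewrite -cats1 big_cat /= big_seq1; congr (_ * _)%R.
  by elim: j => [|j IH]; rewrite ?big_nil// big_cons exprS IH.
apply: esum_prodset_ge => // -[] _; last first.
  by split; [rewrite subr_ge0 ltW|exact: Y_ge].
split; first exact: ltW.
by apply: block_ge; [exact: ltW|rewrite esum_set1// lee_fin].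
Qed.

(** Runs of different lengths are disjoint, and p^j (1 - p) summed over j < k telescopes to 1 - p^k,
    where p is [w a]. *)
Let runs_ge k : (1 - w a ^+ k)%:E <=
  \esum_(c in runs k) (\prod_(s <- c) \prod_(x <- s) w x)%:E.
Proof.
elim: k => [|k IH].
  by rewrite expr0 subrr esum_ge0// => c _; rewrite lee_fin prodr_ge0.
rewrite (esumID (run k)) => [|c _]; last by rewrite lee_fin prodr_ge0.
have -> : (1 - w a ^+ k.+1 = w a ^+ k * (1 - w a) + (1 - w a ^+ k))%R.
  by rewrite exprS; ring.
rewrite EFinD; apply: leeD.
  apply: le_trans (run_ge k) (le_esum_subset _ _) => c kc.
  by split=> //; exists k.
apply: le_trans IH (le_esum_subset _ _) => c [j jk jc]; split.
  by exists j => //; exact: ltnW.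
by move=> /run_size; rewrite (run_size jc) => -[jkE]; rewrite jkE ltnn in jk.
Qed.

Let word_ge k m : (w a ^+ k * (1 - w a) * (1 - w a ^+ k) ^+ m)%:E <=
  \esum_(u in word k m) (\prod_(c <- u) \prod_(s <- c) \prod_(x <- s) w x)%:E.
Proof.
have /andP[wa0 wa1] := wa.
have -> : (w a ^+ k * (1 - w a) * (1 - w a ^+ k) ^+ m = \prod_(b <- true :: nseq m false)
    if b then w a ^+ k * (1 - w a) else 1 - w a ^+ k)%R.
  rewrite big_cons; congr (_ * _)%R.
  by elim: m => [|m IH]; rewrite ?big_nil// big_cons exprS IH.
apply: esum_prodset_ge => [c|[] _]; first by rewrite prodr_ge0.
  by split; [rewrite mulr_ge0 ?exprn_ge0 ?subr_ge0// ltW|exact: run_ge].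
by split; [rewrite subr_ge0 exprn_ile1// ltW|exact: runs_ge].
Qed.

Lemma esum_necklaces : \esum_(s in necklaces) (\prod_(x <- s) w x)%:E = +oo.
Proof.
have /andP[wa0 wa1] := wa.
have qpos : (0 < 1 - w a)%R by rewrite subr_gt0.
(* The disjoint union of all the sets [word k m], tagged by [k] and [m]; flattening is injective on
   it. *)
pose D := setT `*`` (fun k => setT `*`` word k).
pose g (z : nat * (nat * seq (seq (seq T)))) := flatten (flatten z.2.2).
have gD : g @` D `<=` necklaces.
  move=> _ [[k [m u]] [/= _ [_ /= ku]] <-]; rewrite /g /=.
  have [n sz] : exists n, size (flatten u) = n.+1.
    case/wordP: ku => c [u' [-> _ /run_size kc _]] /=.
    by exists (k + size (flatten u'))%N; rewrite size_cat kc.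
  have liftu := word_lifts ku; rewrite sz in liftu; split; first by exists n.
  by split; [rewrite liftu|exact: word_marks ku].
have ginj : set_inj D g.
  move=> [k [m u]] [k' [m' u']] /set_mem[/= _ [_ /= ku]] /set_mem[/= _ [_ /= ku']].
  exact: word_inj ku ku'.
apply/eqP; rewrite -leye_eq -(esum_cst_pinfty qpos).
apply: le_trans (le_esum_subset _ gD); rewrite esum_image//.
pose W u := (\prod_(c <- u) \prod_(s <- c) \prod_(x <- s) w x)%R.
have W0 u : (0 <= W u)%R by do 2 (apply: prodr_ge0 => ? _); exact: weight_ge0.
rewrite (eq_esum (b := fun z => (W z.2.2)%:E)) => [|z _]; last first.
  by rewrite /g !big_flatten.
rewrite -(@esum_esum _ _ _ setT (fun k => setT `*`` word k) (fun k z => (W z.2)%:E));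
  last by move=> *; rewrite lee_fin.
apply: le_esum => k _.
rewrite -(@esum_esum _ _ _ setT (word k) (fun m u => (W u)%:E)); last first.
  by move=> *; rewrite lee_fin.
(* For fixed [k], the geometric series of first term p^k and ratio 1 - p^k leaves a mass of at least
   1 - p, independent of [k]. *)
apply: (@le_trans _ _ (\esum_(m in [set: nat])
    ((1 - w a)%:E * (w a ^+ k * (1 - w a ^+ k) ^+ m)%:E))).
  apply: le_trans (le_mule_esum _ _ _); last first.
  - by move=> m; rewrite lee_fin mulr_ge0 ?exprn_ge0 ?subr_ge0 ?exprn_ile1// ltW.
  - exact: ltW.
  rewrite -[leLHS]mule1 lee_pmul2l ?lte_fin//; apply: esum_geometric_ge1.
  by rewrite exprn_gt0// exprn_ile1// ltW.
apply: le_esum => m _; apply: le_trans (word_ge k m).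
by rewrite -EFinM lee_fin mulrA (mulrC (1 - w a)%R).
Qed.

End Necklaces.

(** * Bundles of parallel edges in a successful graph *)

Section Successful.
Variables (R : realType) (U : choiceType).

Lemma weight_ge0 (G : graph R U) (e : edge G) : 0 <= weight e.
Proof. by have /andP[/ltW] := weight_in01 e. Qed.

(** The only positive real solution is 1, but the infinite value also solves the equation. *)
Lemma cube_eq_ge1 (c : \bar R) : 0 < c -> c * (c * c) = c -> 1 <= c.
Proof.
case: c => [c||]//; last by rewrite leey.
by rewrite -!EFinM lte_fin lee_fin => c0 [] e; nra.
Qed.

(* A hat-edge from v to w of weight c has a reverse of weight c; going back and
   forth along them is a path of weight c ^ 3, so c ^ 3 = c. *)
Lemma bundle_weight_ge1 (G : graph R U) (e : edge G) :
    symmetric_graph (simplify G) -> graph_eq (gpow (simplify G) 3) (simplify G) ->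
  1 <= \esum_(x in edges G (src e) (tgt e)) weight x.
Proof.
move=> symG [_ [phi [_ phiE]]].
have bundle_gt0 : 0 < \esum_(x in edges G (src e) (tgt e)) weight x.
  have /andP[we0 _] := weight_in01 e; apply: lt_le_trans we0 _.
  rewrite -[leLHS](esum_set1 (t := e) (a := @weight _ _ G))//; last exact: weight_ge0.
  by apply: le_esum_subset => _ ->.
have hP : `[< edges G (src e) (tgt e) !=set0 >] by apply/asboolP; exists e.
pose h : edge (simplify G) :=
  (exist _ ([` src_vert e], [` tgt_vert e])%fset hP : hedge G).
have h_edge : edges (simplify G) (src e) (tgt e) h by [].
have [rev [[revP _ _] revw]] := symG _ _ (src_vert e) (tgt_vert e).
have [/= qs qt] := revP _ h_edge; have /= qw := revw _ h_edge.
pose hrh : 3.-tuple (edge (simplify G)) := [tuple h; rev h; h].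
have pathP : is_path_from (val [` src_vert e]%fset) hrh.
  by apply/and4P; split=> //; apply/eqP; rewrite /= ?qs ?qt.
pose P : kpath (simplify G) 3 := exist _ ([` src_vert e]%fset, hrh) pathP.
have [Ps Pt Pw] := phiE P; apply: cube_eq_ge1 => //.
(* The weight of a hat-edge depends only on its endpoints, and [phi P] has the same endpoints as
   [h]. *)
have weightE (y : edge (simplify G)) :
  weight y = \esum_(x in edges G (src y) (tgt y)) weight x by [].
have : pweight hrh = weight h by rewrite -[RHS]/(hweight h) -[LHS]Pw weightE Ps Pt.
by rewrite /pweight /= !big_cons big_nil mule1 qw.
Qed.

End Successful.

(** * Alternating cycles and the interaction *)

Section AlternatingCycles.
Variables (R : realType) (U : choiceType) (G H : graph R U).
Let T := edge (gunion G H).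

Definition alternating : rel T :=
  [rel e f | consecutive e f && (colour e != colour f)].

Definition bundle (e : T) : bool * (U * U) := (colour e, (src e, tgt e)).

Lemma alternating_cycleE (s : seq T) :
  alternating_cycle s <-> s != [::] /\ cycle alternating s.
Proof.
rewrite /alternating_cycle /is_cycle; case: s => [|e s]; first by split=> [[]|[]].
rewrite /alternating /= path_relI; split; first by case=> -[_ ->] ->.
by move=> [_ /andP[]].
Qed.

(** Alternation depends on bundles only, so edges may be replaced by parallel ones of the same
    colour. *)
Lemma alternating_map_cycle (s : seq T) : cycle alternating s =
  cycle [rel x y : bool * (U * U) | (x.2.2 == y.2.1) && (x.1 != y.1)] (map bundle s).
Proof. by rewrite cycle_map. Qed.

Lemma uweight_in01 (e : T) : 0 < weight e <= 1.
Proof. by case: e => e; exact: weight_in01. Qed.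

Let w (e : T) : R := fine (weight e).

Let wE (e : T) : (w e)%:E = weight e.
Proof.
have /andP[e0 e1] := uweight_in01 e.
by rewrite fineK// fin_numElt (lt_trans _ e0)//= (le_lt_trans e1)// ltry.
Qed.

Let w_gt0 (e : T) : (0 < w e)%R.
Proof. by rewrite -lte_fin wE; have /andP[] := uweight_in01 e. Qed.

Let w_le1 (e : T) : (w e <= 1)%R.
Proof. by rewrite -lee_fin wE; have /andP[] := uweight_in01 e. Qed.

Let pweightE (s : seq T) : pweight s = (\prod_(e <- s) w e)%:E.
Proof. by rewrite -prodEFin; apply: eq_bigr => e _; rewrite wE. Qed.

Lemma circuit_weight_circuit_of (s : seq T) : circuit_weight (circuit_of s) = pweight s.
Proof.
rewrite /circuit_weight; have [i _ <-] : circuit_of s (xget [::] (circuit_of s)).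
  by apply: (@xgetPex _ [::] (circuit_of s)); exists s; exists 0%N => //; rewrite rot0.
by apply: perm_big; rewrite perm_rot.
Qed.

(** This is x <= - log (1 - x) for x <= 1, and a product of weights is at most 1. *)
Lemma le_circuit_lne (s : seq T) :
  pweight s <= - lne (1 - circuit_weight (circuit_of s)).
Proof.
rewrite circuit_weight_circuit_of leeNr; apply: le_lne1Dx.
rewrite leeN2 pweightE lee_fin; elim: s => [|e s IH]; rewrite ?big_nil// big_cons.
by apply: mulr_ile1 => //; [exact: ltW|apply: prodr_ge0 => x _; exact: ltW].
Qed.

(** * Circuits parallel to powers of a shortest alternating cycle *)

Section Minimal.
Variables (a : T) (t : seq T).
Hypothesis alt_at : alternating_cycle (a :: t).
Hypothesis min_at :
  forall s : seq T, alternating_cycle s -> (size (a :: t) <= size s)%N.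

(** If [x] in [t] were parallel to [a], the part of the cycle before [x] would close up on [a] into
    a shorter alternating cycle. *)
Lemma minimal_bundle : bundle a \notin map bundle t.
Proof.
apply/mapP => -[x xt ax]; move: xt alt_at min_at => /splitPr[t1 t2].
move=> /alternating_cycleE[_]; rewrite /= rcons_cat cat_path /= => /and3P[pt1 lx _].
have /alternating_cycleE alt1 : (a :: t1) != [::] /\ cycle alternating (a :: t1).
  split=> //=; rewrite rcons_path pt1 /=.
  by move: ax lx; rewrite /bundle /alternating /consecutive /= => -[-> -> _].
by move=> /(_ _ alt1); rewrite /= size_cat /=; lia.
Qed.

(** In a proper power the edge [a] would occur again in [t]. *)
Lemma minimal_circuit : Cycl G H (circuit_of (a :: t)).
Proof.
exists (a :: t); split=> //; split; first by case: alt_at.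
move=> [[|b s] [[|[|k]] [[//= _ _] // _ [ab tE]]]].
have := minimal_bundle; rewrite tE map_cat mem_cat negb_or => /andP[_].
by rewrite /= -ab mem_head.
Qed.

(** The word alternates because its bundles are those of a power of [a :: t]. Were it a proper power
    of [r], rotation by [size r] would fix it, against [lyndon_like_rot]. *)
Lemma necklace_circuit (s : seq T) : necklaces bundle a t s -> Cycl G H (circuit_of s).
Proof.
move=> [[n sE] lyn]; exists s.
have alt_s : alternating_cycle s.
  apply/alternating_cycleE; split; first by case: (s) sE.
  rewrite alternating_map_cycle sE; apply: cycle_flatten_nseq.
  by rewrite -alternating_map_cycle; case/alternating_cycleE: alt_at.
split=> //; split; first by case: alt_s.
move=> [r [k [[r0 _] k2 rE]]].
case: k k2 rE => [|[|k]]// _ rE.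
have rot_s : rot (size r) s = s by rewrite rE rot_flatten_nseq.
have r_lt : (size r < size s)%N.
  rewrite rE /= !size_cat -[X in (X < _)%N]addn0 ltn_add2l.
  by case: (r) r0.
have := lyndon_like_rot lyn (i := size r); rewrite rot_s => /(_ lyn r_lt)/eqP.
by rewrite size_eq0 (negbTE r0).
Qed.

Lemma circuit_of_necklaces_inj : set_inj (necklaces bundle a t) (@circuit_of T).
Proof.
move=> s s' /set_mem[_ lyn] /set_mem[_ lyn'] ss'.
have : circuit_of s s' by rewrite ss'; exists 0%N => //; rewrite rot0.
move=> [i _ si]; case: (leqP (size s) i) => i_lt; first by rewrite -si rot_oversize.
by rewrite -si in lyn' *; rewrite (lyndon_like_rot lyn lyn' i_lt) rot0.
Qed.

End Minimal.

Theorem interaction_eq0_or_pinfty :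
    (forall e : edge G, 1 <= \esum_(x in edges G (src e) (tgt e)) weight x) ->
    (forall e : edge H, 1 <= \esum_(x in edges H (src e) (tgt e)) weight x) ->
  interaction G H = 0 \/ interaction G H = +oo.
Proof.
move=> G1 H1.
(* The colour is part of the bundle, so a bundle of the union contains the image of a whole bundle
   of [G] or of [H]. *)
have bundle_ge1 (e : T) : 1 <= \esum_(y in [set y | bundle y = bundle e]) (w y)%:E.
  under eq_esum do rewrite wE.
  case: e => e; [apply: le_trans (G1 e) _|apply: le_trans (H1 e) _].
    rewrite -(@esum_image _ _ T (edges G (src e) (tgt e)) inl (@weight _ _ (gunion G H))).
      by apply: le_esum_subset => _ [x [sx tx] <-]; rewrite /= /bundle /= sx tx.
    by move=> x y _ _ [].
  rewrite -(@esum_image _ _ T (edges H (src e) (tgt e)) inr (@weight _ _ (gunion G H))).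
    by apply: le_esum_subset => _ [x [sx tx] <-]; rewrite /= /bundle /= sx tx.
  by move=> x y _ _ [].
have [CE|/set0P[_ [s0 [alt0 _ _]]]] := eqVneq (Cycl G H) set0.
  by left; rewrite /interaction CE esum_set0.
right; apply/eqP; rewrite -leye_eq.
have exn : exists n, `[< exists2 s : seq T, alternating_cycle s & size s = n >].
  by exists (size s0); apply/asboolP; exists s0.
case: (ex_minnP exn) => n /asboolP[s alt_s <-] min_n.
have min_s (s' : seq T) : alternating_cycle s' -> (size s <= size s')%N.
  by move=> alt_s'; apply: min_n; apply/asboolP; exists s'.
have [/hasP[x xs wx]|] := boolP (has (fun e => w e < 1)%R s).
  have [i t rot_s] := rot_to xs.
  have alt_xt : alternating_cycle (x :: t).
    case/alternating_cycleE: alt_s => s_neq0 cyc_s.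
    by apply/alternating_cycleE; split=> //; rewrite -rot_s rot_cycle.
  have min_xt (s' : seq T) : alternating_cycle s' -> (size (x :: t) <= size s')%N.
    by rewrite -rot_s size_rot; exact: min_s.
  have xt := minimal_bundle alt_xt min_xt.
  rewrite -(esum_necklaces (w := w) (fun e => ltW (w_gt0 e)) xt) ?w_gt0//.
  (* Necklaces give distinct circuits, each contributing at least its weight. *)
  apply: (@le_trans _ _ (\esum_(c in [set circuit_of s | s in necklaces bundle x t])
      - lne (1 - circuit_weight c))).
    rewrite esum_image; last exact: circuit_of_necklaces_inj.
    by apply: le_esum => s' _; rewrite -pweightE; exact: le_circuit_lne.
  by apply: le_esum_subset => _ [s' ns' <-]; exact: necklace_circuit ns'.
move=> /hasPn w1.
have Cs : Cycl G H (circuit_of s).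
  case: s alt_s min_s {w1 min_n} => [|x t] alt_s min_s; first by case: alt_s => -[].
  exact: minimal_circuit.
have pws : pweight s = 1.
  rewrite pweightE big_seq big1// => e /w1; rewrite -leNgt => w1e.
  by apply/eqP; rewrite eq_le w_le1.
have lnE : - lne (1 - circuit_weight (circuit_of s)) = +oo.
  by rewrite circuit_weight_circuit_of pws subee// le0_lneNy.
rewrite -{1}lnE -[leLHS](esum_set1 (t := circuit_of s)
  (a := fun c => - lne (1 - circuit_weight c))) ?lnE//.
by apply: le_esum_subset => _ ->.
Qed.

End AlternatingCycles.

Theorem mainTheorem4 (R : realType) (U : choiceType)
    (A : project R U -> Prop) (hA : conduct A) :
  ~ (true_conduct A /\ true_conduct (perp A)).
Proof.
move=> [[a Aa [wa symA cubeA _]] [b Ab [wb symB cubeB _]]].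
(* Both wagers vanish, so the measurement of [b] and [a] is the interaction, and orthogonality
   excludes both of its possible values. *)
have [_] := Ab a Aa; rewrite /measurement wa wb !add0e.
by have [->|->] := interaction_eq0_or_pinfty
  (fun e => bundle_weight_ge1 e symB cubeB) (fun e => bundle_weight_ge1 e symA cubeA).
Qed.
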